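(* Let $n>30$ be an integer such that the inequality $f(n)<0$ fails, i.e. $f(n)=\frac{\psi(n)}{n}-e^{\gamma}\log\log n\ge 0$. Then $$\frac{\psi(m)}{m}<\frac{\psi(n)}{n}\quad\text{for every positive integer } m<n,$$ and hence $n$ is a primorial number $N_k$ or one of its multiples smaller than $N_{k+1}$; that is, there are integers $k\ge 1$ and $l\ge 1$ with $n=lN_k<N_{k+1}$.
   Context: The Dedekind psi function is defined for positive integers $n$ by $\psi(n)=n\prod_{p\mid n}\left(1+\frac1p\right)$, where the product is over the primes $p$ dividing $n$. $\gamma\approx 0.577$ is Euler's constant and $\log$ is the natural logarithm. $p_i$ denotes the $i$-th prime ($p_1=2$), and $N_k=\prod_{i=1}^k p_i$ is the $k$-th primorial number. *)

(* Defs.v *)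
From HB Require Import structures.
From mathcomp Require Import all_boot all_order all_algebra.
From mathcomp Require Import all_classical all_reals all_analysis.

Set Implicit Arguments.
Unset Strict Implicit.
Unset Printing Implicit Defensive.

Import Order.TTheory GRing.Theory Num.Theory.
Import numFieldNormedType.Exports.

Local Open Scope ring_scope.
Local Open Scope classical_set_scope.

(* [primes n] is the duplicate-free list of the prime divisors of n > 0. *)
Definition dedekind_psi (R : realType) (n : nat) : R :=
  n%:R * \prod_(p <- primes n) (1 + p%:R^-1).

(* [series harmonic n] is 1 + 1/2 + ... + 1/n. *)
Definition euler_gamma (R : realType) : R :=
  limn (fun n : nat => series harmonic n - ln n%:R : R).

Definition psi_gap (R : realType) (n : nat) : R :=
  dedekind_psi R n / n%:R - expR (euler_gamma R) * ln (ln n%:R).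

Lemma ex_prime_above (m : nat) : exists p, (m < p)%N && prime p.
Proof. by have [p mp pp] := prime_above m; exists p; rewrite mp pp. Qed.

Definition next_prime (m : nat) : nat := ex_minn (ex_prime_above m).

(* Indexed from 1: nth_prime 1 = 2, nth_prime 2 = 3; nth_prime 0 = 0 is unused. *)
Definition nth_prime (i : nat) : nat := iter i next_prime 0%N.

Definition primorial (k : nat) : nat := (\prod_(1 <= i < k.+1) nth_prime i)%N.

(* Main.v *)
From Stdlib Require Import NArith.
Require Import Defs.
From mathcomp Require Import all_boot all_order all_algebra.
From mathcomp Require Import zify ring lra.
From mathcomp Require Import all_classical all_reals all_analysis.

Set Implicit Arguments.
Unset Strict Implicit.
Unset Printing Implicit Defensive.

Import Order.TTheory GRing.Theory Num.Theory.
Import numFieldNormedType.Exports.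
Local Open Scope ring_scope.

(** No integer n > 30 satisfies psi(n)/n >= e^gamma ln ln n, so the hypothesis
    on n is contradictory and both conclusions follow at once.

    The reason is Mertens' product theorem. Since 1 + 1/p = (1 - 1/p^2)/(1 - 1/p),
    the product of 1 + 1/p over the primes p <= x is asymptotic to
    (6/pi^2) e^gamma ln x, and psi(n)/n is largest, for a given size of n, when
    the primes dividing n are the first ones, which run up to about ln n. Hence
    psi(n)/n is asymptotically at most 0.61 e^gamma ln ln n, and the factor 0.61
    leaves room for elementary explicit estimates.

    Large n (ln n >= 512). Let x be the integer part of ln n. The primes of n
    beyond x contribute a factor at most exp(1/ln x), because their logarithms
    sum to at most ln n < x + 1 [psi_prod_primes_le]. For the primes up to x,
    Chebyshev's bound prod_(p <= m) p <= 4^m [prod_primes_upto_le] and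
    Legendre's formula for m! [prod_exp_div_le_fact] give
    sum_(p <= m) ln p / p <= ln m + C with an explicit C [log_recip_sum_le].
    Partial summation started at 512 turns this into a bound on
    sum_(512 < p <= x) 1/p [recip_sum_increase]. Starting there matters: only the
    upper constant C and the exact values at 512 enter, and the error is
    divided by ln 512. The outcome is psi(n)/n < 1.76 ln ln n [psi_prod_upto_lt].

    Small n (ln n < 512). If n has k prime divisors, they dominate the first k
    primes one by one, so psi(n)/n is at most the product of 1 + 1/p over the
    first k primes and n is at least their product. As k <= 101 in this range,
    five groups of values of k and a check of 31 <= n < 60 suffice
    [psi_lt_finite].

    Both parts use e^gamma >= 1.76 [expR_gamma_ge]. All numerical facts reduce to
    inequalities between binary integers, with 0.69 <= ln 2 <= 0.6935 as the only
    transcendental input. *)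

(** * Products of primes: Chebyshev and Legendre *)

Definition primes_upto (n : nat) : seq nat := [seq p <- iota 0 n.+1 | prime p].

Arguments primes_upto : simpl never.

Lemma mem_primes_upto p n : (p \in primes_upto n) = prime p && (p <= n)%N.
Proof. by rewrite mem_filter mem_iota add0n ltnS. Qed.

Lemma primes_upto_gt0 n : all (leq 1) (primes_upto n).
Proof. by apply/allP => p; rewrite mem_primes_upto => /andP[/prime_gt0]. Qed.

Lemma uniq_primes_upto n : uniq (primes_upto n).
Proof. by rewrite filter_uniq // iota_uniq. Qed.

Lemma primes_uptoS n :
  primes_upto n.+1 =
  if prime n.+1 then rcons (primes_upto n) n.+1 else primes_upto n.
Proof.
rewrite /primes_upto -[in LHS]addn1 iotaD filter_cat add0n /=.
by case: ifP => _; rewrite ?cats1 ?cats0.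
Qed.

Lemma big_primes_uptoS (T : Type) (idx : T) (op : Monoid.com_law idx) n F :
  \big[op/idx]_(p <- primes_upto n.+1) F p =
  op (\big[op/idx]_(p <- primes_upto n) F p)
     (if prime n.+1 then F n.+1 else idx).
Proof.
rewrite primes_uptoS; case: ifP => _ /=; last by rewrite Monoid.mulm1.
by rewrite -cats1 big_cat big_seq1.
Qed.

Lemma prod_primes_le n : (0 < n -> \prod_(p <- primes n) p <= n)%N.
Proof.
move=> n0; rewrite {2}(prod_prime_decomp n0) /primes big_map.
rewrite big_seq [X in (_ <= X)%N]big_seq.
apply: leq_prod => -[p e] /mem_prime_decomp[pp e0 _] /=.
by rewrite -{1}(expn1 p) leq_exp2l // prime_gt1.
Qed.

Lemma dvdn_prod_uniq_primes s m :
  uniq s -> all prime s -> (forall p, p \in s -> p %| m)%N ->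
  (\prod_(p <- s) p %| m)%N.
Proof.
elim: s => [|p s IH] /=; first by rewrite big_nil dvd1n.
case/andP=> ps us /andP[pp as_] H; rewrite big_cons Gauss_dvd.
  rewrite H ?mem_head // IH // => q qs; apply: H; rewrite inE qs orbT //.
rewrite prime_coprime //; apply/negP; rewrite Euclid_dvd_prod //.
rewrite big_has; case/hasP => q qs; rewrite dvdn_prime2 // ?(allP as_ q qs) // => /eqP pq.
by rewrite pq qs in ps.
Qed.

Lemma dvdn_prime_fact n p : prime p -> (p %| n`!)%N = (p <= n)%N.
Proof.
move=> pp; apply/idP/idP => [|pn]; last by rewrite dvdn_fact // prime_gt0.
elim: n => [|n IH]; first by rewrite dvdn1 => /eqP p1; rewrite p1 in pp.
rewrite factS Euclid_dvdM // => /orP[/dvdn_leq->//|/IH]; exact: leqW.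
Qed.

(** Strong induction on n. If n > 2 is prime, then n = 2m + 1 and every prime in
    (m + 1, n] divides the binomial coefficient 'C(n, m), which is at most 4^m
    because it occurs twice in the expansion of (1 + 1)^n. If n is not prime,
    it adds nothing to the product. *)
Lemma prod_primes_upto_le n : (\prod_(p <- primes_upto n) p <= 4 ^ n)%N.
Proof.
have [k] := ubnP n; elim: k n => // k IH [_|n]; first by rewrite /primes_upto /= big_nil.
rewrite ltnS => nk.
case: n nk => [_|[_|n nk]]; [by rewrite /primes_upto /= big_nil | by rewrite /primes_upto /= big_seq1|].
have [/even_prime[//|on]|np] := boolP (prime n.+3); last first.
  rewrite big_primes_uptoS (negbTE np) /= muln1.
  by apply: leq_trans (IH n.+2 nk) _; rewrite leq_exp2l.
have : (2 < n.+3)%N by []; move: nk on; move: n.+3 => N nk on N3 {n}.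
pose m := N./2; have Nm : N = (m + m.+1)%N by rewrite -[LHS]odd_double_half on /m -addnn; lia.
have split : perm_eq (primes_upto N)
    (primes_upto m.+1 ++ [seq p <- primes_upto N | (m.+1 < p)%N]).
  apply: uniq_perm; first exact: uniq_primes_upto.
    rewrite cat_uniq uniq_primes_upto (filter_uniq _ (uniq_primes_upto _)) andbT /=.
    apply/hasPn => p; rewrite mem_filter => /andP[mp _].
    by rewrite /= mem_primes_upto leqNgt mp andbF.
  move=> p; rewrite mem_cat !mem_primes_upto mem_filter mem_primes_upto.
  case: (prime p) => /=; rewrite ?andbF //.
  by case: leqP => //= pm; rewrite (leq_trans pm) //; lia.
rewrite (perm_big _ split) big_cat /=.
have -> : (4 ^ N = 4 ^ m.+1 * 4 ^ m)%N by rewrite -expnD Nm addnC.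
apply: leq_mul; first by apply: IH; lia.
have binle : ('C(N, m) <= 4 ^ m)%N.
  have -> : (4 ^ m = 2 ^ N.-1)%N.
    by rewrite (_ : 4 = 2 ^ 2)%N // -expnM; congr (_ ^ _)%N; lia.
  have Nm1 : (N - m = m.+1)%N by lia.
  have : ('C(N, m) + 'C(N, m.+1) <= 2 ^ N)%N.
    have mN1 : (m < N.+1)%N by lia.
    have mN2 : (m.+1 < N.+1)%N by lia.
    rewrite (Pascal 1 1) (bigD1 (Ordinal mN1)) //= (bigD1 (Ordinal mN2)) /=; last first.
      by rewrite -val_eqE /= eqn_leq ltnn.
    by rewrite !exp1n !muln1 addnA leq_addr.
  rewrite -Nm1 bin_sub ?addnn -?muln2; last lia.
  by rewrite -[in X in (_ <= X)%N -> _](prednK (ltnW (ltnW N3))) expnSr muln2 -addnn; lia.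
apply: leq_trans binle; apply: dvdn_leq; first by rewrite bin_gt0 Nm leq_addr.
apply: dvdn_prod_uniq_primes.
- exact: filter_uniq (uniq_primes_upto _).
- by apply/allP => p; rewrite mem_filter mem_primes_upto => /and3P[].
move=> p; rewrite mem_filter mem_primes_upto => /and3P[mp pp pN].
have mN : (m <= N)%N by lia.
have : (p %| N`!)%N by rewrite dvdn_prime_fact.
rewrite -(bin_fact mN) !Euclid_dvdM // !(dvdn_prime_fact _ pp) (_ : N - m = m.+1)%N; last lia.
by rewrite leqNgt (ltnW mp) leqNgt mp /= !orbF.
Qed.

(** Only the first-order terms of Legendre's formula for n!. Going from n to n + 1
    multiplies the left side by the distinct primes dividing n + 1, whose
    product is at most n + 1. *)
Lemma prod_exp_div_le_fact n :
  (\prod_(p <- primes_upto n) p ^ (n %/ p) <= n`!)%N.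
Proof.
elim: n => [|n IH]; first by rewrite /primes_upto /= big_nil.
have -> : (\prod_(p <- primes_upto n.+1) p ^ (n.+1 %/ p) =
   \prod_(p <- primes_upto n.+1) p ^ (p %| n.+1) *
   \prod_(p <- primes_upto n.+1) p ^ (n %/ p))%N.
  rewrite -big_split /= big_seq [RHS]big_seq; apply: eq_bigr => p.
  rewrite mem_primes_upto => /andP[pp _].
  by rewrite divnS ?prime_gt0 // expnD.
rewrite factS; apply: leq_mul; last first.
  rewrite big_primes_uptoS /=; case: ifP => _; rewrite ?muln1 //.
  by rewrite divn_small ?expn0 ?muln1.
apply: leq_trans (prod_primes_le (ltn0Sn n)).
have E : perm_eq (primes n.+1) [seq p <- primes_upto n.+1 | p %| n.+1]%N.
  apply: uniq_perm (primes_uniq _) (filter_uniq _ (uniq_primes_upto _)) _.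
  move=> p; rewrite mem_primes mem_filter mem_primes_upto.
  case: (prime p) => //=; rewrite ?andbF //.
  by case: (boolP (p %| n.+1)%N) => // /dvdn_leq->.
rewrite (perm_big _ E) /= big_filter [X in (_ <= X)%N]big_mkcond /=; apply: leq_prod => p _.
by case: ifP.
Qed.

(** * Elementary inequalities for the logarithm *)

Lemma ln_le_subr1 (R : realType) (x : R) : 0 < x -> ln x <= x - 1.
Proof. by move=> x0; rewrite -{1}(subrK 1 x) addrC le_ln1Dx //; lra. Qed.

Lemma ln_ge_1subV (R : realType) (x : R) : 0 < x -> 1 - x^-1 <= ln x.
Proof.
move=> x0; have := @ln_le_subr1 R x^-1; rewrite invr_gt0 => /(_ x0).
by rewrite lnV //; lra.
Qed.

Lemma ln_prod (R : realType) (I : eqType) (s : seq I) (F : I -> R) :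
  (forall i, i \in s -> 0 < F i) ->
  ln (\prod_(i <- s) F i) = \sum_(i <- s) ln (F i).
Proof.
elim: s => [|i s IH] F0; first by rewrite !big_nil ln1.
have Fs j : j \in s -> 0 < F j by move=> js; apply: F0; rewrite inE js orbT.
rewrite !big_cons lnM ?posrE ?IH ?F0 ?mem_head //.
by rewrite big_seq; apply: prodr_gt0 => j /Fs.
Qed.

(** * Explicit upper bounds of Mertens type *)

Section Mertens.
Variable R : realType.
Implicit Types n x : nat.

Definition recip_sum n : R := \sum_(p <- primes_upto n) p%:R^-1.

(** Mertens' first sum, which equals ln n + O(1). *)
Definition log_recip_sum n : R := \sum_(p <- primes_upto n) ln p%:R / p%:R.

Definition psi_prod (s : seq nat) : R := \prod_(p <- s) (1 + p%:R^-1).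

Lemma prime_gt0r p : prime p -> 0 < p%:R :> R.
Proof. by move=> /prime_gt0; rewrite ltr0n. Qed.

Lemma theta_le n : \sum_(p <- primes_upto n) ln p%:R <= n%:R * (2 * ln 2) :> R.
Proof.
rewrite -ln_prod; last first.
  by move=> p; rewrite mem_primes_upto => /andP[/prime_gt0r].
have -> : n%:R * (2 * ln 2) = ln (4 ^ n)%:R :> R.
  have -> : (4 ^ n = 2 ^ (2 * n))%N by rewrite expnM.
  by rewrite natrX lnXn // -(mulr_natl (ln _)) natrM; ring.
rewrite -natr_prod ler_ln ?posrE ?ltr0n ?expn_gt0 ?ler_nat ?prod_primes_upto_le //.
rewrite big_seq; apply: prodn_cond_gt0 => p.
by rewrite mem_primes_upto => /andP[/prime_gt0].
Qed.

(** A weak form of Stirling's formula, n! <= n^(n+1) e^(1-n), by induction from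
    ln (1 + 1/n) >= 1/(n + 1). *)
Lemma ln_fact_le n : (0 < n)%N -> ln n`!%:R <= (n.+1)%:R * ln n%:R - n%:R + 1 :> R.
Proof.
case: n => // n _; elim: n => [|n IH]; first by rewrite ln1; lra.
rewrite factS natrM lnM ?posrE ?ltr0n ?fact_gt0 //.
have n0 : 0 < n.+1%:R :> R by rewrite ltr0n.
have n1 : 0 < n.+2%:R :> R by rewrite ltr0n.
have := @ln_ge_1subV R (n.+2%:R / n.+1%:R) (divr_gt0 n1 n0).
rewrite invf_div ln_div ?posrE // => H.
have H2 : 1 <= n.+2%:R * (ln n.+2%:R - ln n.+1%:R) :> R.
  apply: le_trans (ler_wpM2l (ltW n1) H).
  by rewrite mulrBr mulrCA mulfV ?gt_eqF // -[n.+2]addn1 natrD; lra.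
have E : n.+3%:R = n.+2%:R + 1 :> R by rewrite -natr1.
have E2 : n.+2%:R = n.+1%:R + 1 :> R by rewrite -natr1.
rewrite E; rewrite E2 in H2 IH *; lra.
Qed.

(** Take logarithms in [prod_exp_div_le_fact] and use that n/p exceeds its floor by
    less than 1; the total loss is Chebyshev's function of n. *)
Lemma log_recip_sum_le_ln_fact n :
  n%:R * log_recip_sum n <= ln n`!%:R + \sum_(p <- primes_upto n) ln p%:R.
Proof.
have H : \sum_(p <- primes_upto n) (n %/ p)%:R * ln p%:R <= ln n`!%:R :> R.
  have -> : \sum_(p <- primes_upto n) (n %/ p)%:R * ln p%:R =
     ln (\prod_(p <- primes_upto n) p ^ (n %/ p))%:R :> R.
    rewrite natr_prod ln_prod => [|p]; last first.
      by rewrite mem_primes_upto => /andP[pp _]; rewrite ltr0n expn_gt0 prime_gt0.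
    rewrite big_seq [RHS]big_seq; apply: eq_bigr => p.
    rewrite mem_primes_upto => /andP[pp _].
    by rewrite natrX lnXn ?prime_gt0r // mulr_natl.
  rewrite ler_ln ?posrE ?ltr0n ?fact_gt0 ?ler_nat ?prod_exp_div_le_fact //.
  rewrite big_seq; apply: prodn_cond_gt0 => p.
  by rewrite mem_primes_upto => /andP[pp _]; rewrite expn_gt0 prime_gt0.
apply: le_trans (_ : _ <= \sum_(p <- primes_upto n) (n %/ p)%:R * ln p%:R +
   \sum_(p <- primes_upto n) ln p%:R) _; last by rewrite lerD2r.
rewrite mulr_sumr -big_split /= big_seq [leRHS]big_seq; apply: ler_sum => p.
rewrite mem_primes_upto => /andP[pp _].
have -> : (n %/ p)%:R * ln p%:R + ln p%:R = (n %/ p).+1%:R * ln p%:R :> R.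
  by rewrite -natr1; ring.
rewrite mulrCA [leRHS]mulrC ler_wpM2l ?ln_ge0 ?ler1n ?prime_gt0 //.
by rewrite ler_pdivrMr ?prime_gt0r // -natrM ler_nat ltnW // ltn_ceil // prime_gt0.
Qed.

Lemma log_recip_sum_le n : (0 < n)%N ->
  log_recip_sum n <= ln n%:R + (2 * ln 2 - 1) + (ln n%:R + 1) / n%:R.
Proof.
move=> n0; have n0r : 0 < n%:R :> R by rewrite ltr0n.
rewrite -(ler_pM2l n0r) mulrDr [_ * (_ / _)]mulrCA mulfV ?gt_eqF // mulr1.
have := log_recip_sum_le_ln_fact n; have := ln_fact_le n0; have := theta_le n.
by rewrite -natr1; lra.
Qed.

(** (1 + ln t)/t is nonincreasing for t >= 1: the error term of
    [log_recip_sum_le] is controlled by its value at the starting point. *)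
Lemma ln_succ_div_le (m n : nat) : (0 < m <= n)%N ->
  (ln n%:R + 1) / n%:R <= (ln m%:R + 1) / m%:R :> R.
Proof.
case/andP=> m0 mn; have n0 : (0 < n)%N := leq_trans m0 mn.
have m0r : 0 < m%:R :> R by rewrite ltr0n.
have n0r : 0 < n%:R :> R by rewrite ltr0n.
have := @ln_le_subr1 R (n%:R / m%:R) (divr_gt0 n0r m0r).
rewrite ln_div ?posrE // => H.
have lm : 0 <= ln m%:R :> R by rewrite ln_ge0 // ler1n.
rewrite ler_pdivrMr //.
have -> : (ln m%:R + 1) / m%:R * n%:R = n%:R / m%:R + ln m%:R * (n%:R / m%:R) :> R by ring.
have : 1 <= n%:R / m%:R :> R by rewrite ler_pdivlMr // mul1r ler_nat.
by move: H; set r := n%:R / m%:R => H r1; nra.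
Qed.

(** Partial summation. Write T and A for the sums of 1/p and of ln p / p. The
    quantity T(x) - A(x)/ln x does not jump at primes; from x to x + 1 it grows
    by A(x) (1/ln x - 1/ln (x + 1)), and A(x) <= ln x + C bounds this by the
    increment of ln ln x - C/ln x. The lower behaviour of A enters only
    through its value at x0. *)
Lemma recip_sum_increase (x0 x : nat) (C : R) : (1 < x0 <= x)%N ->
  (forall y, (x0 <= y)%N -> log_recip_sum y <= ln y%:R + C) ->
  recip_sum x - recip_sum x0 <=
    ln (ln x%:R) - ln (ln x0%:R) + 1 + (C - log_recip_sum x0) / ln x0%:R.
Proof.
case/andP=> x01 x0x HC.
have lpos y : (x0 <= y)%N -> 0 < ln y%:R :> R.
  by move=> xy; rewrite ln_gt0 // ltr1n (leq_trans x01).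
have key : recip_sum x - log_recip_sum x / ln x%:R + C / ln x%:R - ln (ln x%:R) <=
  recip_sum x0 - log_recip_sum x0 / ln x0%:R + C / ln x0%:R - ln (ln x0%:R).
  rewrite -(subnKC x0x); elim: (x - x0)%N => [|d]; first by rewrite addn0.
  apply: le_trans; rewrite addnS; have := leq_addr d x0; move: (x0 + d)%N => y xy.
  have ly := lpos y xy; have ly1 := lpos y.+1 (leqW xy).
  have -> : recip_sum y.+1 - log_recip_sum y.+1 / ln y.+1%:R =
      recip_sum y - log_recip_sum y / ln y.+1%:R.
    rewrite /recip_sum /log_recip_sum !big_primes_uptoS /=.
    case: ifP => _; last by rewrite !addr0.
    by field; rewrite gt_eqF //= nat1r pnatr_eq0.
  have lny : ln y%:R <= ln y.+1%:R :> R.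
    by rewrite ler_ln ?posrE ?ltr0n ?ler_nat // (leq_trans _ xy) // ltnW.
  have := @ln_ge_1subV R (ln y.+1%:R / ln y%:R) (divr_gt0 ly1 ly).
  rewrite invf_div ln_div ?posrE // => H1.
  have H2 : (log_recip_sum y - C) * ((ln y%:R)^-1 - (ln y.+1%:R)^-1) <=
            ln y%:R * ((ln y%:R)^-1 - (ln y.+1%:R)^-1).
    rewrite ler_wpM2r ?subr_ge0 ?lef_pV2 ?posrE //.
    by have := HC y xy; lra.
  have H3 : ln y%:R * ((ln y%:R)^-1 - (ln y.+1%:R)^-1) = 1 - ln y%:R / ln y.+1%:R :> R.
    by field; rewrite !gt_eqF.
  rewrite H3 in H2; lra.
have lx := lpos x x0x.
have : (log_recip_sum x - C) / ln x%:R <= 1.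
  by rewrite ler_pdivrMr // mul1r; have := HC x x0x; lra.
lra.
Qed.

Lemma psi_prod_gt0 s : 0 < psi_prod s.
Proof. by apply: prodr_gt0 => p _; rewrite ltr_pwDl // invr_ge0. Qed.

Lemma psi_prod_le_expR s : psi_prod s <= expR (\sum_(p <- s) p%:R^-1).
Proof.
rewrite /psi_prod expR_sum; apply: ler_prod => p _.
by rewrite expR_ge1Dx addr_ge0 // invr_ge0.
Qed.

Lemma psi_prod_upto_le (x0 x : nat) : (x0 <= x)%N ->
  psi_prod (primes_upto x) <=
  psi_prod (primes_upto x0) * expR (recip_sum x - recip_sum x0).
Proof.
move=> x0x; rewrite -(subnKC x0x); elim: (x - x0)%N => [|d IH].
  by rewrite addn0 subrr expR0 mulr1.
rewrite addnS /psi_prod /recip_sum !big_primes_uptoS /=.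
rewrite addrAC expRD mulrA; apply: ler_pM => //.
- exact/ltW/psi_prod_gt0.
- by case: ifP => // _; rewrite addr_ge0 // invr_ge0.
- by case: ifP => _; rewrite ?expR0 ?expR_ge1Dx.
Qed.

(** Each prime p > x dividing n satisfies 1/p <= ln p / ((x + 1) ln x), and the
    logarithms of the primes of n sum to at most ln n < x + 1. So these primes
    cost a factor exp(1/ln x), and no lower bound on Chebyshev's function is
    needed to compare ln n with the largest prime. *)
Lemma psi_prod_primes_le (n x : nat) : (0 < n)%N -> (1 < x)%N ->
  x%:R <= (ln n%:R : R) < x.+1%:R ->
  psi_prod (primes n) <= psi_prod (primes_upto x) * expR ((ln x%:R)^-1).
Proof.
move=> n0 x1 /andP[xL Lx].
have x0r : 0 < x%:R :> R by rewrite ltr0n ltnW.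
have lx : 0 < ln x%:R :> R by rewrite ln_gt0 // ltr1n.
rewrite /psi_prod (bigID (leq^~ x)) /=; apply: ler_pM.
- by apply: prodr_ge0 => p _; rewrite addr_ge0 // invr_ge0.
- by apply: prodr_ge0 => p _; rewrite addr_ge0 // invr_ge0.
- rewrite -[leLHS]big_filter [leRHS](bigID (mem (primes n))) /=.
  rewrite -[X in _ <= X * _]big_filter.
  have E : perm_eq [seq p <- primes n | (p <= x)%N] [seq p <- primes_upto x | p \in primes n].
    apply: uniq_perm (filter_uniq _ (primes_uniq _)) (filter_uniq _ (uniq_primes_upto _)) _.
    move=> p; rewrite [in LHS]mem_filter [in RHS]mem_filter mem_primes_upto mem_primes n0 /=.
    by case: (prime p) => /=; rewrite ?andbF // andbC.
  rewrite (perm_big _ E) ler_peMr //.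
    exact/ltW/psi_prod_gt0.
  elim/big_rec: _ => // p y _ y1.
  by apply: mulr_ege1 => //; rewrite lerDl invr_ge0.
rewrite -big_filter; apply: le_trans (psi_prod_le_expR _) _; rewrite ler_expR.
have L0 : 0 < ln n%:R :> R by apply: lt_le_trans xL.
have x1r : 0 < x.+1%:R :> R by rewrite ltr0n.
have lx1 : ln x%:R <= ln x.+1%:R :> R by rewrite ler_ln ?posrE ?ler_nat.
apply: le_trans (_ : _ <= \sum_(p <- [seq p <- primes n | ~~ (p <= x)%N])
    ln p%:R / (x.+1%:R * ln x%:R)) _.
  rewrite big_seq [leRHS]big_seq; apply: ler_sum => p.
  rewrite mem_filter -ltnNge mem_primes => /andP[xp /and3P[pp _ _]].
  have p0 := prime_gt0r pp.
  have xp1 : p%:R^-1 * x.+1%:R <= 1 :> R.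
    by rewrite mulrC ler_pdivrMr // mul1r ler_nat.
  have lxp : ln x%:R <= ln p%:R :> R by rewrite ler_ln ?posrE ?ler_nat // ltnW.
  rewrite ler_pdivlMr ?mulr_gt0 // mulrA -[leRHS]mul1r.
  by apply: ler_pM; rewrite // ?mulr_ge0 // ?invr_ge0 // ltW.
rewrite -mulr_suml ler_pdivrMr ?mulr_gt0 // mulrC mulfK ?gt_eqF //.
apply: le_trans (ltW Lx); rewrite big_filter.
apply: le_trans (_ : _ <= \sum_(p <- primes n) ln p%:R) _.
  rewrite [leRHS](bigID (leq^~ x)) /= lerDr; apply: sumr_ge0 => p _.
  by case: p => [|p]; [rewrite ln0 | rewrite ln_ge0 // ler1n].
have pp p : p \in primes n -> (0 < p)%N.
  by rewrite mem_primes => /andP[/prime_gt0].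
rewrite -ln_prod => [|p /pp]; last by rewrite ltr0n.
rewrite -natr_prod ler_ln ?posrE ?ltr0n ?ler_nat ?prod_primes_le //.
by rewrite big_seq; apply: prodn_cond_gt0.
Qed.

End Mertens.

(** * Certified numerical bounds by binary arithmetic *)

Section BinaryArithmetic.
Variable R : realType.
Local Notation "a %:NR" := ((N.to_nat a)%:R : R) (at level 2, format "a %:NR").

Lemma NR_le a b : N.leb a b -> a%:NR <= b%:NR.
Proof. by move=> /N.leb_le ab; rewrite ler_nat; lia. Qed.

Lemma NR_M a b : (a * b)%num%:NR = a%:NR * b%:NR.
Proof. by rewrite N2Nat.inj_mul natrM. Qed.

Lemma NR_D a b : (a + b)%num%:NR = a%:NR + b%:NR.
Proof. by rewrite N2Nat.inj_add natrD. Qed.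

Lemma NR_of_nat m : (N.of_nat m)%:NR = m%:R.
Proof. by rewrite Nat2N.id. Qed.

Lemma NR_X a b : (N.pow a (N.of_nat b))%:NR = a%:NR ^+ b.
Proof.
elim: b => [|b IH]; first by rewrite N.pow_0_r.
by rewrite Nat2N.inj_succ N.pow_succ_r' NR_M IH exprS.
Qed.

Lemma NR_div a b : (N.div a b)%:NR * b%:NR <= a%:NR.
Proof.
rewrite -NR_M; apply: NR_le; apply/N.leb_le.
by have [->|b0] := N.eq_dec b 0; [lia | rewrite N.mul_comm; apply: N.Div0.mul_div_le].
Qed.

Lemma NR_div_ge a b : b <> 0%num -> a%:NR <= (N.div a b + 1)%num%:NR * b%:NR.
Proof.
move=> b0; rewrite -NR_M; apply: NR_le; apply/N.leb_le.
have := N.mul_succ_div_gt a b b0; lia.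
Qed.

(** The products below have hundreds of bits, hence binary integers; the map
    N.to_nat transports the resulting inequalities to R without being
    evaluated. *)
Definition prodN (s : seq nat) : N := foldr (fun p a => N.mul (N.of_nat p) a) 1%num s.

Lemma prodNE s : (prodN s)%:NR = \prod_(p <- s) p%:R.
Proof.
by elim: s => [|p s IH]; rewrite ?big_nil // big_cons /= NR_M NR_of_nat IH.
Qed.

(** Cross-multiplied form of prod (1 + 1/p) <= a/b. *)
Definition psi_leb (s : seq nat) (a b : nat) : bool :=
  N.leb (N.mul (N.of_nat b) (prodN (map S s))) (N.mul (N.of_nat a) (prodN s)).

Lemma psi_lebP s a b : all (leq 1) s -> (0 < b)%N -> psi_leb s a b ->
  psi_prod R s <= a%:R / b%:R.
Proof.
move=> s0 b0 /NR_le; rewrite !NR_M !NR_of_nat !prodNE big_map => H.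
have sp : 0 < \prod_(p <- s) p%:R :> R.
  by rewrite big_seq; apply: prodr_gt0 => p /(allP s0); rewrite ltr0n.
have E : psi_prod R s * \prod_(p <- s) p%:R = \prod_(p <- s) p.+1%:R.
  rewrite /psi_prod -big_split /= big_seq [RHS]big_seq; apply: eq_bigr => p ps.
  have p0 : p%:R != 0 :> R by rewrite pnatr_eq0 -lt0n (allP s0).
  by rewrite mulrDl mul1r mulVf // natr1.
by rewrite ler_pdivlMr ?ltr0n // -(ler_pM2r sp) mulrAC E mulrC.
Qed.

(** A lower bound for ln x as a rational multiple of ln 2, as precise as desired
    by increasing b. *)
Lemma ln_ge_log2 (a : N) (b : nat) (x : R) : 0 < x -> a%:NR = x ->
  (N.log2 (N.pow a (N.of_nat b)))%:NR * ln 2 <= b%:R * ln x.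
Proof.
move=> x0 ax; have a0 : N.lt 0 a by case: a ax => // /esym x00; rewrite x00 ltxx in x0.
have [H _] := N.log2_spec (N.pow a (N.of_nat b)) (ltac:(apply/N.neq_0_lt_0/N.pow_nonzero; lia)).
set e := N.log2 _ in H *.
have : (2%num)%:NR ^+ N.to_nat e <= x ^+ b.
  by rewrite -ax -!NR_X N2Nat.id; apply: NR_le; apply/N.leb_le.
rewrite -ler_ln ?posrE ?exprn_gt0 ?ltr0n // !lnXn ?ltr0n //.
by rewrite !mulr_natl.
Qed.

(** Fixed-point lower approximation, rounded down term by term, of M b times the
    sum over s of log2 p / p. *)
Definition log2_recip_sumN (M : N) (b : nat) (s : seq nat) : N :=
  foldr (fun p acc => N.add (N.div (N.mul M
    (N.log2 (N.pow (N.of_nat p) (N.of_nat b)))) (N.of_nat p)) acc) 0%num s.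

Lemma log2_recip_sumN_le M b s : all (leq 1) s ->
  (log2_recip_sumN M b s)%:NR * ln 2 <=
  M%:NR * b%:R * \sum_(p <- s) ln p%:R / p%:R.
Proof.
elim: s => [|p s IH] /=; first by rewrite big_nil mulr0 mul0r.
case/andP=> p0 /IH {}IH; rewrite big_cons NR_D mulrDl mulrDr lerD //.
have p0r : 0 < p%:R :> R by rewrite ltr0n.
have l2 : 0 < ln 2 :> R by rewrite ln_gt0 // ltr1n.
have := NR_div (M * N.log2 (N.pow (N.of_nat p) (N.of_nat b))) (N.of_nat p).
rewrite NR_of_nat -ler_pdivlMr // => H.
apply: le_trans (ler_wpM2r (ltW l2) H) _.
rewrite NR_M mulrAC -mulrA -!mulrA ler_wpM2l // ?ler0n //.
rewrite !mulrA ler_wpM2r ?invr_ge0 ?ler0n //.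
by apply: ln_ge_log2 => //; rewrite NR_of_nat.
Qed.

(** Fixed-point lower approximation of M times a segment of the harmonic series;
    each of the l terms loses less than 1. *)
Definition recip_sumN (M : N) (m l : nat) : N :=
  foldr (fun k acc => N.add (N.div M (N.of_nat k)) acc) 0%num (iota m l).

Lemma recip_sumN_le M m l : (0 < m)%N ->
  (recip_sumN M m l)%:NR <= M%:NR * \sum_(m <= k < m + l) k%:R^-1.
Proof.
rewrite /recip_sumN /index_iota addKn.
elim: l m => [|l IH] m m0 /=; first by rewrite big_nil mulr0.
rewrite big_cons NR_D mulrDr lerD ?IH //.
have := NR_div M (N.of_nat m).
by rewrite NR_of_nat ler_pdivlMr ?ltr0n.
Qed.

Lemma recip_sumN_ge M m l : (0 < m)%N ->
  M%:NR * \sum_(m <= k < m + l) k%:R^-1 <= (recip_sumN M m l + N.of_nat l)%num%:NR.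
Proof.
rewrite NR_D NR_of_nat /recip_sumN /index_iota addKn.
elim: l m => [|l IH] m m0 /=; first by rewrite big_nil mulr0 addr0.
rewrite big_cons NR_D mulrDr -natr1.
have /IH {}IH : (0 < m.+1)%N by [].
have := @NR_div_ge M (N.of_nat m) (ltac:(lia)).
rewrite NR_of_nat -ler_pdivrMr ?ltr0n // NR_D (_ : 1%num%:NR = 1) //; lra.
Qed.

Definition recip_sum_leb (M : N) (m l a b : nat) : bool :=
  N.leb (N.of_nat b * (recip_sumN M m l + N.of_nat l)) (N.of_nat a * M).

Definition recip_sum_geb (M : N) (m l a b : nat) : bool :=
  N.leb (N.of_nat a * M) (N.of_nat b * recip_sumN M m l).

Lemma NR_gt0 M : N.lt 0 M -> 0 < M%:NR.
Proof. by rewrite ltr0n; lia. Qed.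

Lemma recip_sum_lebP M m l a b : N.lt 0 M -> (0 < m)%N -> (0 < b)%N ->
  recip_sum_leb M m l a b -> \sum_(m <= k < m + l) k%:R^-1 <= a%:R / b%:R :> R.
Proof.
move=> /NR_gt0 M0 m0 b0 /NR_le; rewrite !NR_M !NR_of_nat => H.
have b0r : 0 < b%:R :> R by rewrite ltr0n.
rewrite ler_pdivlMr // -(ler_pM2l M0) mulrA [_ * a%:R]mulrC.
apply: le_trans H; rewrite [leRHS]mulrC ler_wpM2r ?ler0n //.
exact: recip_sumN_ge.
Qed.

Lemma recip_sum_gebP M m l a b : N.lt 0 M -> (0 < m)%N -> (0 < b)%N ->
  recip_sum_geb M m l a b -> a%:R / b%:R <= \sum_(m <= k < m + l) k%:R^-1 :> R.
Proof.
move=> /NR_gt0 M0 m0 b0 /NR_le; rewrite !NR_M !NR_of_nat => H.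
have b0r : 0 < b%:R :> R by rewrite ltr0n.
rewrite ler_pdivrMr // -(ler_pM2l M0) mulrA [_ * a%:R]mulrC.
apply: le_trans H _; rewrite [leLHS]mulrC ler_wpM2r ?ler0n //.
exact: recip_sumN_le.
Qed.

Definition log2_recip_sum_geb (M : N) (b : nat) (s : seq nat) (a : nat) : bool :=
  N.leb (M * N.of_nat b * N.of_nat a) (log2_recip_sumN M b s).

Lemma log2_recip_sum_gebP M b s a : N.lt 0 M -> (0 < b)%N -> all (leq 1) s ->
  log2_recip_sum_geb M b s a ->
  a%:R * ln 2 <= \sum_(p <- s) ln p%:R / p%:R :> R.
Proof.
move=> /NR_gt0 M0 b0 s0 /NR_le; rewrite !NR_M !NR_of_nat => H.
have Mb0 : 0 < M%:NR * b%:R by rewrite mulr_gt0 // ltr0n.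
have l2 : 0 <= ln 2 :> R by rewrite ln_ge0 // ler1n.
rewrite -(ler_pM2l Mb0) mulrA.
exact: le_trans (ler_wpM2r l2 H) (log2_recip_sumN_le _ _ s0).
Qed.

(** A certificate for ln (ln T) >= 0.69 c/d: the first test gives
    ln T >= (a/b) ln 2, the second 0.69 a/b >= u/v, and the third
    ln (u/v) >= (c/d) ln 2. *)
Definition lnln_geb (T : N) (a b u v c d : nat) : bool :=
  [&& N.leb (N.pow 2 (N.of_nat a)) (N.pow T (N.of_nat b)),
      N.leb (100 * N.of_nat b * N.of_nat u) (69 * N.of_nat a * N.of_nat v) &
      N.leb (N.pow 2 (N.of_nat c) * N.pow (N.of_nat v) (N.of_nat d))
            (N.pow (N.of_nat u) (N.of_nat d))].

Lemma lnln_gebP T a b u v c d (x : R) :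
  69 / 100 <= ln 2 :> R ->
  [&& 0 < b, 0 < u, 0 < v & 0 < d]%N -> lnln_geb T a b u v c d ->
  T%:NR <= x -> 1 < x -> 69 / 100 * (c%:R / d%:R) <= ln (ln x).
Proof.
move=> l2 /and4P[b0 u0 v0 d0] /and3P[/NR_le H1 /NR_le H2 /NR_le H3] Tx x1.
rewrite !NR_M !NR_X !NR_of_nat in H1 H2 H3.
have x0 : 0 < x by lra.
have b0r : 0 < b%:R :> R by rewrite ltr0n.
have d0r : 0 < d%:R :> R by rewrite ltr0n.
have u0r : 0 < u%:R :> R by rewrite ltr0n.
have v0r : 0 < v%:R :> R by rewrite ltr0n.
have E1 : a%:R * ln 2 <= b%:R * ln x.
  have : 2 ^+ a <= x ^+ b :> R.
    by apply: le_trans H1 _; rewrite lerXn2r ?nnegrE ?ler0n // ltW.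
  rewrite -ler_ln ?posrE ?exprn_gt0 ?ltr0n // !lnXn ?ltr0n //.
  by rewrite !mulr_natl.
have E2 : u%:R / v%:R <= ln x.
  rewrite ler_pdivrMr // -(ler_pM2l b0r).
  have : 69 / 100 * a%:R <= b%:R * ln x.
    by apply: le_trans E1; rewrite mulrC ler_wpM2l.
  have -> : b%:R * (ln x * v%:R) = (b%:R * ln x) * v%:R by ring.
  move/(ler_wpM2r (ltW v0r)) => E; apply: le_trans E.
  have -> : 69 / 100 * a%:R * v%:R = (69 * a%:R * v%:R) / 100 :> R by ring.
  rewrite ler_pdivlMr //.
  by have -> : b%:R * u%:R * 100 = 100 * b%:R * u%:R :> R by ring.
have E3 : c%:R * ln 2 <= d%:R * ln (u%:R / v%:R) :> R.
  have : 2 ^+ c <= (u%:R / v%:R) ^+ d :> R.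
    by rewrite exprMn exprVn ler_pdivlMr ?exprn_gt0.
  rewrite -ler_ln ?posrE ?exprn_gt0 ?divr_gt0 ?ltr0n // !lnXn ?divr_gt0 ?ltr0n //.
  by rewrite !mulr_natl.
apply: le_trans (_ : _ <= ln (u%:R / v%:R)) _; last first.
  by rewrite ler_ln ?posrE ?ln_gt0 // divr_gt0.
rewrite mulrA ler_pdivrMr // [leRHS]mulrC; apply: le_trans E3.
by rewrite mulrC ler_wpM2l.
Qed.

End BinaryArithmetic.

(** * Numerical values of ln 2 and of Euler's constant *)

Section Constants.
Variable R : realType.

(** The rectangle rule for the integral of 1/t. *)
Lemma ln_sub_bounds (m n : nat) : (0 < m <= n)%N ->
  \sum_(m.+1 <= k < n.+1) k%:R^-1 <= ln n%:R - ln m%:R :> R /\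
  ln n%:R - ln m%:R <= \sum_(m <= k < n) k%:R^-1 :> R.
Proof.
case/andP=> m0 mn; rewrite -(telescope_sumr (fun k => ln k%:R : R) mn) big_add1 /=.
have step k : (m <= k)%N ->
    (k.+1)%:R^-1 <= ln k.+1%:R - ln k%:R :> R /\ ln k.+1%:R - ln k%:R <= k%:R^-1 :> R.
  move=> mk; have k0 : 0 < k%:R :> R by rewrite ltr0n (leq_trans m0).
  have k1 : 0 < k.+1%:R :> R by rewrite ltr0n.
  have q0 := divr_gt0 k1 k0.
  have E : k%:R = k.+1%:R - 1 :> R by rewrite -natr1 addrK.
  rewrite -ln_div ?posrE //; split.
    apply: le_trans (ln_ge_1subV q0); rewrite invf_div.
    by rewrite E mulrBl mulfV ?gt_eqF // subKr mul1r.
  apply: le_trans (ln_le_subr1 q0) _; rewrite -natr1.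
  by rewrite mulrDl mulfV ?gt_eqF // addrC addKr mul1r.
by split; apply: ler_sum_nat => k /andP[mk _]; have [] := step k mk.
Qed.

Lemma ln2_ge : 69 / 100 <= ln 2 :> R.
Proof.
have [+ _] := @ln_sub_bounds 100 200 isT.
have -> : 200%:R = 2 * 100%:R :> R by rewrite -natrM.
rewrite lnM ?posrE ?ltr0n // addrK; apply: le_trans.
have chk : recip_sum_geb 1000000 101 100 69 100 by vm_compute.
have M0 : N.lt 0 1000000 by [].
exact: (@recip_sum_gebP R _ 101 100 69 100 M0 isT isT chk).
Qed.

Lemma ln2_le : ln 2 <= 1387 / 2000 :> R.
Proof.
have [_] := @ln_sub_bounds 1024 2048 isT.
have -> : 2048%:R = 2 * 1024%:R :> R by rewrite -natrM.
rewrite lnM ?posrE ?ltr0n // addrK => /le_trans; apply.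
have chk : recip_sum_leb 100000000 1024 1024 1387 2000 by vm_compute.
have M0 : N.lt 0 100000000 by [].
exact: (@recip_sum_lebP R _ 1024 1024 1387 2000 M0 isT isT chk).
Qed.

Lemma harmonic_sumE n : series harmonic n = \sum_(1 <= k < n.+1) k%:R^-1 :> R.
Proof. by rewrite big_add1. Qed.

(** The sequence H_n - ln (n + 1) increases and is bounded by 1, and
    H_(n+1) - ln (n + 1) differs from it by 1/(n + 1); so it has the same limit,
    Euler's constant, and each of its terms is a lower bound. *)
Lemma euler_gamma_ge n :
  series harmonic n - ln n.+1%:R <= euler_gamma R.
Proof.
pose v n : R := series harmonic n - ln n.+1%:R.
have vS k : v k <= v k.+1.
  have [_] := @ln_sub_bounds k.+1 k.+2 (leqnSn _).
  rewrite big_nat1 /v !seriesEnat /= big_nat_recr //=.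
  by move: (\sum_(0 <= i < k) _) (k.+1%:R^-1) => s r; lra.
have vnd : nondecreasing_seq v by apply/nondecreasing_seqP.
have vb : has_ubound (range v).
  exists 1 => _ [k _ <-]; have [+ _] := @ln_sub_bounds 1 k.+1 isT.
  rewrite ln1 subr0 /v harmonic_sumE; case: k => [|k]; first by rewrite big_nil ln1; lra.
  rewrite (big_ltn (isT : 1 < k.+2)%N) (@big_nat_recr _ _ _ k.+2 2) //= invr1.
  have : 0 <= k.+2%:R^-1 :> R by rewrite invr_ge0.
  by move: (\sum_(2 <= i < k.+2) _) (k.+2%:R^-1) => s r; lra.
have vcv : cvgn v := nondecreasing_is_cvgn vnd vb.
suff -> : euler_gamma R = limn v by apply: nondecreasing_cvgn_le.
apply/cvg_lim => //.
rewrite -(cvg_shiftS (fun n => series harmonic n - ln n%:R)) -[limn v]addr0.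
have -> : (fun n => series harmonic n.+1 - ln n.+1%:R) = (fun n => v n + harmonic n).
  by apply/funext => k; rewrite /v !seriesEnat /= big_nat_recr //=; ring.
exact: cvgD vcv cvg_harmonic.
Qed.

(** From H_255 >= 6.12 and ln 256 = 8 ln 2 one gets gamma >= 0.572, whereas
    1.76^11 <= 2^9 gives ln 1.76 <= (9/11) ln 2 < 0.568. *)
Lemma expR_gamma_ge : 44 / 25 <= expR (euler_gamma R).
Proof.
have g : 612 / 100 - 8 * ln 2 <= euler_gamma R.
  apply: le_trans (euler_gamma_ge 255).
  have -> : 256%:R = 2 ^+ 8 :> R by rewrite -natrX.
  rewrite lnXn // -(mulr_natl (ln _)) harmonic_sumE lerD2r.
  have chk : recip_sum_geb 1000000 1 255 612 100 by vm_compute.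
  have M0 : N.lt 0 1000000 by [].
  exact: (@recip_sum_gebP R _ 1 255 612 100 M0 isT isT chk).
have H : 11 * ln (44 / 25) <= 9 * ln 2 :> R.
  rewrite (mulr_natl (ln _) 11) (mulr_natl (ln _) 9) -!lnXn //.
  rewrite ler_ln ?posrE ?exprn_gt0 //; lra.
have := ln2_le => l2.
rewrite -[leLHS]lnK ?posrE //.
rewrite ler_expR; lra.
Qed.

End Constants.

(** * Comparison with the first primes *)

(** Induction on the length of the interval scanned: when m is prime it is below
    the head of s and strictly below the rest, and when it is not, all elements
    of s exceed m. *)
Lemma dominated_by_first_primes (m l : nat) (s : seq nat) :
  sorted ltn s -> all prime s -> all (leq m) s ->
  let q := [seq p <- iota m l | prime p] in
  (size s <= size q)%N -> all2 leq (take (size s) q) s.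
Proof.
elim: l m s => [|l IH] m s ss ps ms /=; first by rewrite leqn0 size_eq0 => /eqP->.
case: ifP => [pm|npm].
  case: s ss ps ms => [//|a s] /= ss /andP[pa ps] /andP[ma _] sq.
  rewrite ma /=; apply: IH => //; first exact: path_sorted ss.
  apply: sub_all (order_path_min ltn_trans ss) => b; exact: leq_ltn_trans.
apply: IH => //; apply/allP => p ps'.
rewrite ltn_neqAle (allP ms) // andbT; apply/eqP => mp.
by move: npm; rewrite mp (allP ps).
Qed.

Lemma all2_leq_prod s t : all2 leq s t -> (\prod_(p <- s) p <= \prod_(p <- t) p)%N.
Proof.
elim: s t => [|a s IH] [|b t] //= /andP[ab /IH st]; rewrite ?big_nil // !big_cons.
exact: leq_mul.
Qed.

Lemma all2_leq_psi_prod (R : realType) s t : all (leq 1) s ->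
  all2 leq s t -> psi_prod R t <= psi_prod R s.
Proof.
rewrite /psi_prod; elim: s t => [|a s IH] [|b t] //= /andP[a0 s0] /andP[ab /IH st].
rewrite !big_cons; apply: ler_pM.
- by rewrite addr_ge0 // invr_ge0.
- exact/ltW/psi_prod_gt0.
- by rewrite lerD2l lef_pV2 ?posrE ?ltr0n ?ler_nat // (leq_trans a0).
- exact: st.
Qed.

Lemma all_take (T : Type) (P : pred T) k s : all P s -> all P (take k s).
Proof. by rewrite -{1}(cat_take_drop k s) all_cat => /andP[]. Qed.

(** Meaningful for k <= 109, the number of primes up to 600. *)
Definition first_primes (k : nat) : seq nat := take k (primes_upto 600).

Lemma size_primes_upto_600 : size (primes_upto 600) = 109.
Proof. by vm_compute. Qed.

Lemma first_primes_gt0 k : all (leq 1) (first_primes k).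
Proof. exact/all_take/primes_upto_gt0. Qed.

Lemma take_primes_upto_dominated N n k :
  (k <= size (primes_upto N))%N -> (k <= size (primes n))%N ->
  all2 leq (take k (primes_upto N)) (take k (primes n)).
Proof.
move=> kN kn; have sk : size (take k (primes n)) = k by rewrite size_takel.
rewrite -{1}sk; apply: dominated_by_first_primes.
- exact: take_sorted (sorted_primes n).
- by apply/allP => p /mem_take; rewrite mem_primes => /andP[].
- by apply/allP.
- by rewrite sk.
Qed.

Lemma first_primes_dominated n k : (k <= 109)%N -> (k <= size (primes n))%N ->
  all2 leq (first_primes k) (take k (primes n)).
Proof.
by move=> k109; apply: take_primes_upto_dominated; rewrite size_primes_upto_600.
Qed.

Lemma prod_first_primes_le n k : (0 < n)%N -> (k <= 109)%N -> (k <= size (primes n))%N ->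
  (\prod_(p <- first_primes k) p <= n)%N.
Proof.
move=> n0 k109 kn.
apply: leq_trans (all2_leq_prod (first_primes_dominated k109 kn)) _.
apply: leq_trans (prod_primes_le n0).
rewrite -{2}(cat_take_drop k (primes n)) big_cat leq_pmulr // big_seq.
by apply: prodn_cond_gt0 => p /mem_drop; rewrite mem_primes => /andP[/prime_gt0].
Qed.

(** * The inequality psi(n)/n < e^gamma ln ln n for n > 30 *)

Section Bound.
Variable R : realType.
Local Notation "a %:NR" := ((N.to_nat a)%:R : R) (at level 2, format "a %:NR").

Lemma psi_prod_first_primes n k : (0 < n)%N -> (size (primes n) <= k <= 109)%N ->
  psi_prod R (primes n) <= psi_prod R (first_primes k).
Proof.
move=> n0 /andP[nk k109].
have nk' := leq_trans nk k109.
apply: le_trans (_ : _ <= psi_prod R (first_primes (size (primes n)))) _.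
  apply: all2_leq_psi_prod (first_primes_gt0 _) _.
  by have := first_primes_dominated nk' (leqnn _); rewrite take_size.
rewrite /first_primes -[in leRHS](subnKC nk) takeD /psi_prod big_cat /= ler_peMr //.
  exact/ltW/psi_prod_gt0.
elim/big_rec: _ => // p y _ y1.
by apply: mulr_ege1 => //; rewrite lerDl invr_ge0.
Qed.

Lemma expR_gamma_lnln_gt (T : N) (a b u v c d : nat) (B x : R) :
  [&& 0 < b, 0 < u, 0 < v & 0 < d]%N -> lnln_geb T a b u v c d ->
  T%:NR <= x -> 1 < x -> B < 3036 / 2500 * (c%:R / d%:R) ->
  B < expR (euler_gamma R) * ln (ln x).
Proof.
move=> pos chk Tx x1 HB.
have := lnln_gebP (ln2_ge R) pos chk Tx x1; set q := c%:R / d%:R in HB * => l.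
have q0 : 0 <= q by rewrite divr_ge0.
have := expR_gamma_ge R; set g := expR _ => g0; nra.
Qed.

(** One group of the small range: the number of prime divisors bounds psi(n)/n
    from above, and n >= T bounds ln (ln n) from below. The numbers
    a, ..., d certify the latter, e/f bounds the product of 1 + 1/p over the
    first k1 primes, and 3036/2500 is 1.76 * 0.69. *)
Lemma psi_lt_of_omega (k1 : nat) (T : N) (a b u v c d e f n : nat) :
  (size (primes n) <= k1 <= 109)%N ->
  [&& 0 < b, 0 < u, 0 < v & 0 < d]%N -> (0 < f)%N ->
  lnln_geb T a b u v c d -> psi_leb (first_primes k1) e f ->
  (1 < n)%N -> T%:NR <= n%:R -> e%:R / f%:R < 3036 / 2500 * (c%:R / d%:R) :> R ->
  psi_prod R (primes n) < expR (euler_gamma R) * ln (ln n%:R).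
Proof.
move=> nk pos f0 chk chk2 n1 Tn HB.
have n0 : (0 < n)%N := ltnW n1.
apply: le_lt_trans (psi_prod_first_primes n0 nk) _.
apply: le_lt_trans (psi_lebP R (first_primes_gt0 k1) f0 chk2) _.
by apply: expR_gamma_lnln_gt pos chk Tn _ HB; rewrite ltr1n.
Qed.

Lemma NR_prod_first_primes_le n k : (0 < n)%N -> (k <= size (primes n))%N -> (k <= 109)%N ->
  forall T, N.leb T (prodN (first_primes k)) -> T%:NR <= n%:R.
Proof.
move=> n0 kn k109 T /(NR_le R) /le_trans; apply.
by rewrite prodNE -natr_prod ler_nat prod_first_primes_le.
Qed.

(** Below 60 only 30 and 42 have three prime divisors; every other n in the range
    has psi(n)/n <= 2, and psi(42)/42 = 16/7. *)
Lemma psi_leb_31_59 :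
  all (fun n => psi_leb (primes n) 2 1 || ((42 <= n)%N && psi_leb (primes n) 16 7)) (iota 31 29).
Proof. by vm_compute. Qed.

Lemma primes_gt0 n : all (leq 1) (primes n).
Proof. by apply/allP => p; rewrite mem_primes => /andP[/prime_gt0]. Qed.

Lemma psi_lt_small n : (30 < n < 60)%N ->
  psi_prod R (primes n) < expR (euler_gamma R) * ln (ln n%:R).
Proof.
move=> /andP[n30 n60]; have n1 : 1 < n%:R :> R by rewrite ltr1n (leq_trans _ n30).
have : n \in iota 31 29 by rewrite mem_iota n30.
move/(allP psi_leb_31_59)/orP => [|/andP[n42]] H; apply: le_lt_trans (psi_lebP R (primes_gt0 n) _ H) _ => //.
  apply: (@expR_gamma_lnln_gt 31 49 10 169 50 7 4) => //; first by rewrite (ler_nat _ 31).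
  lra.
apply: (@expR_gamma_lnln_gt 42 124 23 93 25 17 9) => //; first by rewrite (ler_nat _ 42).
lra.
Qed.

(** Grouping k = omega(n) as k <= 3, k = 4, 5..7, 8..19, 20..101. In each group
    the product over the first k primes is taken at the largest k, and the lower
    bound for n comes from that product at the smallest k (60 when k <= 3). *)
Lemma psi_lt_finite n : (30 < n)%N -> (size (primes n) <= 101)%N ->
  psi_prod R (primes n) < expR (euler_gamma R) * ln (ln n%:R).
Proof.
move=> n30 s101; have n1 : (1 < n)%N := leq_trans (isT : 1 < 31)%N n30.
have n0 := ltnW n1.
have [n60|n60] := ltnP n 60; first by apply: psi_lt_small; rewrite n30.
have [s3|s3] := leqP (size (primes n)) 3.
  apply: (@psi_lt_of_omega 3 60 59 10 4 1 2 1 12 5); rewrite ?s3 ?(ler_nat _ 60) //; lra.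
have [s4|s4] := leqP (size (primes n)) 4.
  apply: (@psi_lt_of_omega 4 210 77 10 5 1 23 10 11 4); rewrite ?s4 //; last lra.
  exact: NR_prod_first_primes_le s3 _ _ _.
have [s7|s7] := leqP (size (primes n)) 7.
  apply: (@psi_lt_of_omega 7 2310 11 1 15 2 29 10 171 50); rewrite ?s7 //; last lra.
  exact: NR_prod_first_primes_le s4 _ _ _.
have [s19|s19] := leqP (size (primes n)) 19.
  apply: (@psi_lt_of_omega 19 9699690 23 1 79 5 39 10 471 100); rewrite ?s19 //; last lra.
  exact: NR_prod_first_primes_le s7 _ _ _.
have lt_val : 69%:R / 10%:R < 3036 / 2500 * (59%:R / 10%:R) :> R by lra.
have chk : lnln_geb (2 ^ 88) 88 1 60 1 59 10 by vm_compute.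
have chk2 : psi_leb (first_primes 101) 69 10 by vm_compute.
have T88 : N.leb (2 ^ 88) (prodN (first_primes 20)) by vm_compute.
have sz : (size (primes n) <= 101 <= 109)%N by rewrite s101.
have pos : [&& 0 < 1, 0 < 60, 0 < 1 & 0 < 10]%N by [].
have f0 : (0 < 10)%N by [].
have Tn := NR_prod_first_primes_le n0 s19 isT T88.
exact: (psi_lt_of_omega sz pos f0 chk chk2 n1 Tn lt_val).
Qed.

(** The product of the first 102 primes exceeds 2^743, whose logarithm is at least
    743 * 0.69 > 512. *)
Lemma size_primes_le n : (0 < n)%N -> ln n%:R < 512 :> R -> (size (primes n) <= 101)%N.
Proof.
move=> n0 ln512; rewrite leqNgt; apply/negP => s101.
have := NR_prod_first_primes_le n0 s101 isT (T := (2 ^ N.of_nat 743)%num) (ltac:(by vm_compute)).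
rewrite NR_X -ler_ln ?posrE ?ltr0n ?exprn_gt0 // lnXn // -(mulr_natl (ln _)).
have := ln2_ge R; lra.
Qed.

Lemma log_recip_sum_512_ge : 7 * ln 2 <= log_recip_sum R 512.
Proof.
(* Rounding down log2 (p^8) and each quotient leaves a sum above 7.04. *)
have chk : log2_recip_sum_geb 1024 8 (primes_upto 512) 7 by vm_compute.
have M0 : N.lt 0 1024 by [].
exact: (log2_recip_sum_gebP R M0 (isT : 0 < 8)%N (primes_upto_gt0 512) chk).
Qed.

Lemma psi_prod_512_le : psi_prod R (primes_upto 512) <= 341 / 50.
Proof.
have chk : psi_leb (primes_upto 512) 341 50 by vm_compute.
exact: (psi_lebP R (primes_upto_gt0 512) (isT : 0 < 50)%N chk).
Qed.

(** With C and A = sum_(p <= 512) ln p / p >= 7 ln 2, the partial summation bound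
    and the factor exp(1/ln x) give at most
    P exp(1 + (C - A + 1)/ln 512) ln x / ln 512, where
    P = prod_(p <= 512) (1 + 1/p) <= 6.82. The exponent is below
    (2/3) ln 2 <= ln 1.6, and 6.82 * 1.6 / (9 * 0.69) < 1.76. *)
Lemma psi_prod_upto_lt (x : nat) : (512 <= x)%N ->
  psi_prod R (primes_upto x) * expR (ln x%:R)^-1 < 44 / 25 * ln x%:R.
Proof.
move=> x512.
have l2 := ln2_ge R.
have l512 : ln 512%:R = 9 * ln 2 :> R.
  have -> : 512%:R = 2 ^+ 9 :> R by rewrite -natrX.
  by rewrite lnXn // mulr_natl.
have lx : 9 * ln 2 <= ln x%:R :> R.
  by rewrite -l512 ler_ln ?posrE ?ltr0n ?ler_nat // (leq_trans _ x512).
pose C : R := (2 * ln 2 - 1) + (9 * ln 2 + 1) / 512%:R.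
have HC y : (512 <= y)%N -> log_recip_sum R y <= ln y%:R + C.
  move=> y512; have y0 : (0 < y)%N by apply: leq_trans y512.
  apply: le_trans (log_recip_sum_le R y0) _; rewrite /C [leRHS]addrA lerD2l -l512.
  by apply: ln_succ_div_le; rewrite y512.
have A7 := log_recip_sum_512_ge.
have := @recip_sum_increase R 512 x C x512 HC; rewrite l512.
move: (recip_sum R x - recip_sum R 512) (psi_prod_upto_le R x512) psi_prod_512_le A7.
have := ltW (psi_prod_gt0 R (primes_upto 512)).
move: (log_recip_sum R 512) (psi_prod R (primes_upto 512)) => A P P0 d Px P512 A7 dle.
have L0 : 0 < ln x%:R :> R by lra.
have e1 : d + (ln x%:R)^-1 <= ln (ln x%:R) - ln (9 * ln 2) + 2 / 3 * ln 2.
  have i1 : (ln x%:R)^-1 <= (9 * ln 2)^-1 :> R by rewrite lef_pV2 ?posrE //; lra.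
  have i2 : 1 + (C - A + 1) / (9 * ln 2) <= 2 / 3 * ln 2.
    have : C - A + 1 <= (2 / 3 * ln 2 - 1) * (9 * ln 2).
      rewrite /C; nra.
    by rewrite -ler_pdivrMr; lra.
  lra.
have e2 : expR (d + (ln x%:R)^-1) <= 8 / 5 * (ln x%:R / (9 * ln 2)).
  apply: le_trans (_ : _ <= expR (ln (ln x%:R) - ln (9 * ln 2) + 2 / 3 * ln 2)) _.
    by rewrite ler_expR.
  have -> : 8 / 5 * (ln x%:R / (9 * ln 2)) = expR (ln (8 / 5) + (ln (ln x%:R) - ln (9 * ln 2))) :> R.
    rewrite expRD expRB !lnK ?posrE //; lra.
  rewrite ler_expR.
  have : 2 * ln 2 <= 3 * ln (8 / 5) :> R.
    rewrite (mulr_natl (ln _) 2) (mulr_natl (ln _) 3) -!lnXn //.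
    by rewrite ler_ln ?posrE ?exprn_gt0 //; lra.
  lra.
apply: le_lt_trans (ler_wpM2r (expR_ge0 _) Px) _.
rewrite -[ltLHS]mulrA -expRD.
have X0 : 0 < expR (d + (ln x%:R)^-1) := expR_gt0 _.
apply: le_lt_trans (_ : 341 / 50 * (8 / 5 * (ln x%:R / (9 * ln 2))) < _).
  by apply: ler_pM => //; exact: ltW.
rewrite !mulrA ltr_pdivrMr; nra.
Qed.

Lemma psi_prod_primes_lt n : (30 < n)%N ->
  psi_prod R (primes n) < expR (euler_gamma R) * ln (ln n%:R).
Proof.
move=> n30; have n0 : (0 < n)%N by apply: leq_trans n30.
have [l512|l512] := ltP (ln n%:R : R) 512.
  by apply: psi_lt_finite => //; apply: size_primes_le.
have L0 : 0 <= ln n%:R :> R by apply: le_trans (ler0n _ _) l512.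
have /andP[xL Lx] := truncn_itv L0; set x := Num.trunc _ in xL Lx.
have x512 : (512 <= x)%N by rewrite -ltnS -(ltr_nat R); apply: le_lt_trans Lx.
have x1 : (1 < x)%N by apply: leq_trans x512.
have x0 : 0 < x%:R :> R by rewrite ltr0n ltnW.
have xLx : x%:R <= (ln n%:R : R) < x.+1%:R by rewrite xL.
apply: le_lt_trans (psi_prod_primes_le n0 x1 xLx) _.
apply: lt_le_trans (psi_prod_upto_lt x512) _.
have llx : ln x%:R <= ln (ln n%:R) :> R.
  by rewrite ler_ln ?posrE // (lt_le_trans x0).
apply: ler_pM => //; last exact: expR_gamma_ge.
by rewrite ln_ge0 // ler1n ltnW.
Qed.

End Bound.

Theorem mainTheorem2 (R : realType) (n : nat) (hn : (30 < n)%N)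
    (hf : 0 <= psi_gap R n) :
  (forall m : nat, (0 < m)%N -> (m < n)%N ->
     dedekind_psi R m / m%:R < dedekind_psi R n / n%:R) /\
  (exists k l : nat, [/\ (1 <= k)%N, (1 <= l)%N,
     n = (l * primorial k)%N & (n < primorial k.+1)%N]).
Proof.
have n0 : n%:R != 0 :> R by rewrite pnatr_eq0 -lt0n (leq_trans _ hn).
have := psi_prod_primes_lt R hn; rewrite ltNge; case/negP.
by move: hf; rewrite /psi_gap /dedekind_psi mulrAC mulfV // mul1r subr_ge0.
Qed.
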